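(* Let $p_0\in(0,1)$ and consider the two-sided all-accept verification cascade with prior $p_0$, latent false-accept distribution $G$ and latent true-accept distribution $H$ (as described in the context). Suppose $G$ and $H$ are probability distributions on $[0,1]$ with no atoms at $1$ and with densities $g,h$ satisfying, as $x\uparrow1$, $$g(x)\sim c_\alpha(1-x)^{b_\alpha-1},\qquad h(x)\sim c_\beta(1-x)^{b_\beta-1},$$ for some constants $c_\alpha,c_\beta,b_\alpha,b_\beta>0$. Then, as $k\to\infty$, $$\ell_k=\ell_0+\ln\frac{c_\beta\,\Gamma(b_\beta)}{c_\alpha\,\Gamma(b_\alpha)}+(b_\alpha-b_\beta)\ln k+o(1),$$ so exactly one of the following three regimes obtains: (i) $b_\alpha>b_\beta$, and then $\ell_k\to+\infty$ and $1-r_k\asymp k^{-(b_\alpha-b_\beta)}$; (ii) $b_\alpha=b_\beta$, and then $r_k\to\sigma\!\left(\ell_0+\ln\frac{c_\beta}{c_\alpha}\right)<1$; (iii) $b_\alpha<b_\beta$, and then $\ell_k\to-\infty$ and $r_k\to0$.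
   Context: Two-sided all-accept cascade: a candidate answer has a random truth label $C\in\{0,1\}$ with $\mathbb{P}(C=1)=p_0$, and is passed through $k$ gates, each returning accept or reject. Given $C=0$, a latent false-accept rate $\alpha$ is drawn from $G$, and conditionally on $\alpha$ the $k$ verdicts are i.i.d., each accept with probability $\alpha$. Given $C=1$, a latent true-accept rate $\beta$ is drawn from $H$, and conditionally on $\beta$ the $k$ verdicts are i.i.d., each accept with probability $\beta$. Define $r_k=\mathbb{P}(C=1\mid\text{all }k\text{ gates accept})$ and $\ell_k=\ln\frac{r_k}{1-r_k}$, so $\ell_0=\ln\frac{p_0}{1-p_0}$. Equivalently $\ell_k=\ell_0+\ln m_k^{(\beta)}-\ln m_k^{(\alpha)}$ with $m_k^{(\alpha)}=\mathbb{E}_{\alpha\sim G}[\alpha^k]$ and $m_k^{(\beta)}=\mathbb{E}_{\beta\sim H}[\beta^k]$. $\sigma(x)=1/(1+e^{-x})$ is the logistic function; $u_k\asymp v_k$ means $u_k/v_k$ is bounded above and below by positive constants for all large $k$. *)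

(* Defs.v *)
From HB Require Import structures.
From mathcomp Require Import all_boot all_order all_algebra.
From mathcomp Require Import all_classical all_reals all_analysis.

Set Implicit Arguments.
Unset Strict Implicit.
Unset Printing Implicit Defensive.

Import Order.TTheory GRing.Theory Num.Theory.
Import numFieldNormedType.Exports.

Local Open Scope classical_set_scope.
Local Open Scope ring_scope.

(* Euler's integral; the value is meaningful for 0 < x only. *)
Definition Gamma (R : realType) (x : R) : R :=
  \int[lebesgue_measure]_(t in `]0, +oo[) (t `^ (x - 1) * expR (- t)).

Definition logit (R : realType) (x : R) : R := ln (x / (1 - x)).

Definition sigma (R : realType) (x : R) : R := 1 / (1 + expR (- x)).

Definition asymp (R : realType) (u v : nat -> R) : Prop :=
  exists a b : R, [/\ 0 < a, 0 < b &
    \forall k \near \oo, a <= u k / v k <= b].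

Definition exactly_one3 (A B C : Prop) : Prop :=
  [/\ A \/ B \/ C, ~ (A /\ B), ~ (A /\ C) & ~ (B /\ C)].

(* Meant for mu carried by [0, 1]; g is unconstrained off [0, 1]. *)
Definition density01 (R : realType) (mu : probability R R) (g : R -> R) : Prop :=
  [/\ measurable_fun (`[0, 1] : set R) g,
      (forall x, x \in `[0, 1]%R -> 0 <= g x) &
      forall B : set R, measurable B -> B `<=` `[0, 1]%classic ->
        mu B = (\int[lebesgue_measure]_(x in B) (g x)%:E)%E].

Definition cond_prob (d : measure_display) (T : measurableType d)
    (R : realType) (P : probability T R) (A B : set T) : R :=
  fine (P (A `&` B)) / fine (P B).

Definition verdict_prob (R : realType) (a : R) (accept : bool) : R :=
  if accept then a else 1 - a.

(* The two-sided cascade with k gates, on an arbitrary probability space. The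
   last two fields express, by integrating against the conditioning variable
   over every event generated by it, that on {C = 0} (resp. {C = 1}) the
   conditional joint law of the verdicts given alpha (resp. beta) is that of k
   independent Bernoulli(alpha) (resp. Bernoulli(beta)) variables. The values of
   alpha on {C = 1} and of beta on {C = 0} are irrelevant and unconstrained. *)
Record cascade (R : realType) (p0 : R) (G H : probability R R) (k : nat) :=
  Cascade {
    cas_disp : measure_display;
    cas_space : measurableType cas_disp;
    cas_P : probability cas_space R;
    cas_C : {RV cas_P >-> bool};
    cas_alpha : {RV cas_P >-> R};
    cas_beta : {RV cas_P >-> R};
    cas_V : 'I_k -> {RV cas_P >-> bool};
    cas_prior : cas_P (cas_C @^-1` [set true]) = p0%:E;
    cas_alpha_law : forall B : set R, measurable B ->
      cond_prob cas_P (cas_alpha @^-1` B) (cas_C @^-1` [set false])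
        = fine (G B);
    cas_beta_law : forall B : set R, measurable B ->
      cond_prob cas_P (cas_beta @^-1` B) (cas_C @^-1` [set true])
        = fine (H B);
    cas_verdicts0 : forall (B : set R) (v : 'I_k -> bool), measurable B ->
      cas_P (cas_C @^-1` [set false] `&` cas_alpha @^-1` B `&`
             [set w | forall i, cas_V i w = v i])
        = (\int[cas_P]_(w in cas_C @^-1` [set false] `&` cas_alpha @^-1` B)
             (\prod_(i < k) verdict_prob (cas_alpha w) (v i))%:E)%E;
    cas_verdicts1 : forall (B : set R) (v : 'I_k -> bool), measurable B ->
      cas_P (cas_C @^-1` [set true] `&` cas_beta @^-1` B `&`
             [set w | forall i, cas_V i w = v i])
        = (\int[cas_P]_(w in cas_C @^-1` [set true] `&` cas_beta @^-1` B)
             (\prod_(i < k) verdict_prob (cas_beta w) (v i))%:E)%E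
  }.

Definition posterior (R : realType) (p0 : R) (G H : probability R R) (k : nat)
    (M : cascade p0 G H k) : R :=
  cond_prob (cas_P M) (cas_C M @^-1` [set true])
    [set w | forall i, cas_V M i w = true].

Definition log_odds (R : realType) (p0 : R) (G H : probability R R) (k : nat)
    (M : cascade p0 G H k) : R := logit (posterior M).

Lemma log_odds0 (R : realType) (p0 : R) (G H : probability R R)
    (M : cascade p0 G H 0) : log_odds M = logit p0.
Proof.
rewrite /log_odds /posterior /cond_prob.
have -> : [set w | forall i, cas_V M i w = true] = setT.
  by apply/seteqP; split => // w _ [].
by rewrite setIT cas_prior probability_setT /= divr1.
Qed.

(* Main.v *)
(** In the scaled moment n^b E[x^n] of a law on [0, 1], the substitution
    x = 1 - s / n gives the integral over s > 0 of
    (1 - s / n)^n n^(b-1) g (1 - s / n), where g is the density; this converges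
    to c s^(b-1) e^(-s), and is dominated by twice this limit once the range of
    s is cut at n d. Hence n^b E[x^n] -> c Gamma(b). The odds of the posterior
    are the ratio of two such moments, weighted by the prior, so that
    ell_n - (ba - bb) ln n converges, and the three regimes are read off the
    sign of ba - bb through r_n = sigma(ell_n). *)

Require Import Defs.
From HB Require Import structures.
From mathcomp Require Import all_boot all_order all_algebra.
From mathcomp Require Import all_classical all_reals all_analysis.
From mathcomp Require Import measurable_realfun ring lra.

Set Implicit Arguments.
Unset Strict Implicit.
Unset Printing Implicit Defensive.

Import Order.TTheory GRing.Theory Num.Theory.
Import numFieldNormedType.Exports.

Local Open Scope classical_set_scope.
Local Open Scope ring_scope.

(** * Transfer of integrals: affine substitution, densities, conditional laws *)

(** By uniqueness of Lebesgue measure it is enough to compare both sides on intervals []x, y]],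
    whose preimage under [s |-> 1 - a * s] is an interval of length [(y - x) / a]. *)
Lemma lebesgue_measure_onemM (R : realType) (a : R) (A : set R) :
  0 < a -> measurable A ->
  lebesgue_measure A = (a%:E * lebesgue_measure [set s | A (1 - a * s)%R])%E.
Proof.
move=> a0 mA.
(* The codomain is typed [measurableTypeR R] so that the pushforward lives on the measurable type
   that carries [lebesgue_measure]. *)
have mphi : measurable_fun [set: R] ((fun s => 1 - a * s) : R -> measurableTypeR R).
  by apply: measurable_funB => //; exact: mulrl_measurable.
pose phi : {mfun _ >-> _} := HB.pack ((fun s => 1 - a * s) : R -> measurableTypeR R)
  (isMeasurableFun.Build _ _ _ _ _ mphi).
apply: (@lebesgue_measure_unique R
  (mscale (NngNum (ltW a0)) (pushforward lebesgue_measure phi))) => // _ [[x y]] _ <-.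
change (lebesgue_measure `]x, y]%classic =
  (a%:E * lebesgue_measure [set s : R | (1 - a * s)%R \in `]x, y]%R])%E).
have -> : [set s : R | 1 - a * s \in `]x, y]%R] = `[(1 - y) / a, (1 - x) / a[%classic.
  apply/seteqP; split => s /=; rewrite !in_itv/= ler_pdivrMr// ltr_pdivlMr//.
    by move=> /andP[? ?]; apply/andP; split; lra.
  by move=> /andP[? ?]; apply/andP; split; lra.
rewrite !lebesgue_measure_itv/= !lte_fin ltr_pdivrMr// divfK ?gt_eqF//.
have -> : (1 - y < 1 - x) = (x < y) by apply/idP/idP; lra.
case: ifP => _; last by rewrite mule0.
by rewrite -!EFinB -EFinM; congr EFin; field; rewrite gt_eqF.
Qed.

Lemma ge0_integral_onemM (R : realType) (a : R) (D : set R) (f : R -> \bar R) :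
  0 < a -> measurable D -> measurable_fun D f ->
  (forall x, D x -> 0 <= f x)%E ->
  (\int[lebesgue_measure]_(x in D) f x =
   a%:E * \int[lebesgue_measure]_(s in [set s : R | D (1 - a * s)%R]) f (1 - a * s)%R)%E.
Proof.
move=> a0 mD mf f0.
have mphi : measurable_fun [set: R] ((fun s => 1 - a * s) : R -> measurableTypeR R).
  by apply: measurable_funB => //; exact: mulrl_measurable.
pose phi : {mfun _ >-> _} := HB.pack ((fun s => 1 - a * s) : R -> measurableTypeR R)
  (isMeasurableFun.Build _ _ _ _ _ mphi).
rewrite (@eq_measure_integral _ _ _ _
    (mscale (NngNum (ltW a0)) (pushforward lebesgue_measure phi))); last first.
  by move=> A mA _; exact: (lebesgue_measure_onemM a0 mA).
rewrite ge0_integral_mscale//; congr (_ * _)%E.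
by rewrite ge0_integral_pushforward// => x /[!inE]; exact: f0.
Qed.

(** [density01] speaks of measures of sets only. Integrals are reached through the Radon-Nikodym
    derivative of [G], which agrees with [g] almost everywhere on [D]. *)
Lemma ge0_integral_density01 (R : realType) (G : probability R R) (g : R -> R)
    (f : R -> \bar R) (D : set R) :
  density01 G g -> G `[0, 1]%classic = 1%E ->
  measurable D -> D `<=` `[0, 1]%classic ->
  measurable_fun D f -> (forall x, D x -> 0 <= f x)%E ->
  (\int[G]_(x in D) f x = \int[lebesgue_measure]_(x in D) (f x * (g x)%:E))%E.
Proof.
move=> [mg g0 Gg] G01 mD D01 mf f0.
(* The density describes [G] inside [0, 1] only; absolute continuity on the whole line also uses
   that [G] has no mass outside. *)
have GC A : measurable A -> G A = G (A `&` `[0, 1]%classic).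
  move=> mA; rewrite -[in LHS](setIT A) -(setUv `[0, 1]%classic) setIUr measureU//=; last 3 first.
  - exact: measurableI.
  - by apply: measurableI => //; exact: measurableC.
  - by rewrite setIACA setICr setI0.
  rewrite [X in (_ + X)%E](_ : _ = 0%E) ?adde0//.
  apply/eqP; rewrite -measure_le0.
  apply: (@le_trans _ _ (G (~` `[0, 1]%classic))).
    by apply: le_measure; rewrite ?inE//=; [apply: measurableI|]; do ?exact: measurableC.
  by rewrite probability_setC// G01 subee.
have mid : measurable_fun [set: R] (idfun : R -> measurableTypeR R).
  by move=> _ A mA; rewrite setTI; exact: mA.
pose i : {mfun R >-> measurableTypeR R} := HB.pack (idfun : R -> measurableTypeR R)
  (isMeasurableFun.Build _ _ _ _ _ mid).
pose G' := distribution G (i : {RV G >-> measurableTypeR R}).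
have Gmu : G' `<< @lebesgue_measure R.
  apply/null_content_dominatesP => A mA A0.
  have -> : G' A = G A by [].
  have mA01 : measurable (A `&` `[0, 1]%classic) by exact: measurableI.
  rewrite GC// Gg//.
  apply: null_set_integral => //.
    apply/measurable_EFinP; apply: measurable_funS mg => //.
  by apply: subset_measure0 A0.
(* Extension of [f] by zero: the Radon-Nikodym change of variables asks for nonnegativity
   everywhere. *)
pose h : R -> \bar R := fun x => if x \in D then f x else 0%E.
have h0 x : (0 <= h x)%E by rewrite /h; case: ifPn => // /[!inE] /f0.
have mh : measurable_fun D h.
  by apply: eq_measurable_fun mf => x xD; rewrite /h xD.
transitivity (\int[G']_(x in D) h x)%E.
  rewrite /G' /distribution ge0_integral_pushforward//.
  by apply: eq_integral => x xD; rewrite /h /= xD.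
have irn := Radon_Nikodym_SigmaFinite.f_integrable Gmu.
rewrite -(Radon_Nikodym_SigmaFinite.change_of_variables Gmu)//.
have mgD : measurable_fun D (EFin \o g).
  by apply/measurable_EFinP; exact: measurable_funS mg.
transitivity (\int[lebesgue_measure]_(x in D) (h x * (g x)%:E))%E; last first.
  by apply: eq_integral => x xD; rewrite /h xD.
apply: ae_eq_integral => //.
- apply: emeasurable_funM => //.
  by apply: measurable_funS (measurable_int _ irn).
- exact: emeasurable_funM.
(* Both densities have the same integral, namely the [G]-measure, over every measurable subset of
   [D]. *)
- apply: ae_eqe_mul2l; apply: integral_ae_eq => //.
    exact: integrableS irn.
  move=> E ED mE; rewrite -Radon_Nikodym_SigmaFinite.f_integral//.
  by apply: Gg => //; exact: subset_trans D01.
Qed.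

(** The hypothesis [law] says that [P] restricted to [E] and pushed forward by [X] is the measure
    [p * nu]; the integral follows this identity of measures. *)
Lemma ge0_integral_conditional_law (d : measure_display) (T : measurableType d)
    (R : realType) (P : probability T R) (X : {RV P >-> R}) (E : set T) (p : R)
    (nu : probability R R) (D : set R) (f : R -> \bar R) :
  0 <= p -> measurable E ->
  (forall B, measurable B -> P (E `&` X @^-1` B) = p%:E * nu B)%E ->
  measurable D -> measurable_fun D f -> (forall x, D x -> 0 <= f x)%E ->
  (\int[P]_(w in E `&` X @^-1` D) f (X w) = p%:E * \int[nu]_(x in D) f x)%E.
Proof.
move=> p0 mE law mD mf f0.
have mX B : measurable B -> measurable (X @^-1` B).
  by move=> mB; rewrite -(setTI (_ @^-1` _)); exact: measurable_funP.
have mEX : measurable (E `&` X @^-1` D) by apply: measurableI => //; exact: mX.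
have mfX : measurable_fun (X @^-1` D) (f \o X).
  apply: (measurable_comp mD) => //; first by move=> _ [w Dw <-].
  exact: measurable_funTS.
rewrite (@eq_measure_integral _ _ _ _ (mrestr P mE)); last first.
  by move=> A mA AE; rewrite /= /mrestr setIidl// => w /AE[].
transitivity (\int[mrestr P mE]_(w in X @^-1` D) (f \o X) w)%E.
  (* The preimage of [D] is split along [E]; the part outside [E] is null for the restricted
     measure. *)
  rewrite -[in RHS](setIT (X @^-1` D)) -(setUv E) setIUr.
  rewrite ge0_integral_setU//; last 5 first.
  - by apply: measurableI => //; exact: mX.
  - by apply: measurableI; [exact: mX|exact: measurableC].
  - by rewrite -setIUr setUv setIT.
  - by rewrite -setIUr setUv setIT => w Dw; exact: f0.
  - by apply/disj_setPS; rewrite setIACA setICr setI0.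
  rewrite setIC [X in (_ + X)%E]null_set_integral ?adde0//.
  - by apply: measurableI; [exact: mX|exact: measurableC].
  - by apply: measurable_funS mfX; [exact: mX|].
  - by rewrite /= /mrestr -setIA setICl setI0.
rewrite -(@ge0_integral_pushforward _ _ _ _ _ X)//; last by move=> x /[!inE]; exact: f0.
rewrite (@eq_measure_integral _ _ _ _ (mscale (NngNum p0) nu)); last first.
  move=> A mA _; rewrite /= /pushforward /mscale /= /mrestr setIC.
  exact: law.
by rewrite ge0_integral_mscale.
Qed.

(** * Powers against exponentials *)

(** With [t = c * s / b] the claim becomes [t^b <= e^(b t)], which is [ln t <= t]. *)
Lemma powR_le_expR (R : realType) (b c s : R) : 0 < b -> 0 < c -> 0 < s ->
  s `^ b <= (b / c) `^ b * expR (c * s).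
Proof.
move=> b0 c0 s0.
have bc0 : 0 < b / c by rewrite divr_gt0.
have -> : s `^ b = (b / c) `^ b * (c * s / b) `^ b.
  by rewrite -powRM ?ltW// ?divr_gt0 ?mulr_gt0//; congr (_ `^ _); field; rewrite !gt_eqF.
rewrite ler_pM2l ?powR_gt0//.
have t0 : 0 < c * s / b by rewrite divr_gt0 ?mulr_gt0.
rewrite /powR gt_eqF// ler_expR mulrC -ler_pdivlMr//.
exact/ltW/ln_sublinear.
Qed.

(** Write [q = e^(-c) * e^(-c)]: one factor absorbs [n^b], the other decays geometrically. The case
    [q = 0] is allowed because the cut [d] used for the moments may equal 1. *)
Lemma cvg_powR_geometric (R : realType) (b q : R) : 0 < b -> 0 <= q < 1 ->
  n%:R `^ b * q ^+ n @[n --> \oo] --> (0 : R).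
Proof.
move=> b0 /andP[]; rewrite le_eqVlt => /predU1P[<- _|q0 q1].
  apply: cvg_near_cst; near=> n; rewrite expr0n.
  by rewrite (_ : (n == 0)%N = false) ?mulr0//; near: n; exists 1%N => // -[].
pose c := - ln q / 2.
have c0 : 0 < c by rewrite divr_gt0// oppr_gt0 ln_lt0// q0.
have qE : q = expR (- c) * expR (- c).
  by rewrite -expRD /c -[LHS]lnK ?posrE//; congr expR; field.
apply: (@squeeze_cvgr _ _ _ _ (cst 0) (fun n => (b / c) `^ b * expR (- c) ^+ n)).
- near=> n; rewrite mulr_ge0 ?powR_ge0 ?exprn_ge0 ?(ltW q0)//=.
  rewrite qE exprMn mulrA ler_pM2r ?exprn_gt0 ?expR_gt0//.
  rewrite -expRM_natr mulNr expRN ler_pdivrMr ?expR_gt0//.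
  apply: powR_le_expR => //; rewrite ltr0n; near: n; exists 1%N => //.
- exact: cvg_cst.
- rewrite -[X in _ --> X](mulr0 ((b / c) `^ b)); apply: cvgM; first exact: cvg_cst.
  apply: cvg_expr; rewrite ger0_norm ?expR_ge0//.
  by rewrite -expR0 ltr_expR oppr_lt0.
Unshelve. all: by end_near. Qed.

(** Squeeze between [exp(- s / (1 - s / n))] and [exp(- s)]. Both bounds are [1 + x <= e^x], at
    [x = (s / n) / (1 - s / n)] and at [x = - s / n]. *)
Lemma cvg_onem_exprn (R : realType) (s : R) : 0 < s ->
  (1 - s / n%:R) ^+ n @[n --> \oo] --> expR (- s).
Proof.
move=> s0.
apply: (@squeeze_cvgr _ _ _ _ (fun n => expR (- (s / (1 - s / n%:R)))) (cst (expR (- s)))).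
- near=> n.
  have n0 : (0 : R) < n%:R by rewrite ltr0n; near: n; exists 1%N.
  have sn : s < n%:R by near: n; exact: nbhs_infty_gtr.
  have x0 : 0 < 1 - s / n%:R by rewrite subr_gt0 ltr_pdivrMr// mul1r.
  have n_neq0 : n%:R != 0 :> R by rewrite gt_eqF.
  apply/andP; split; last first.
    have -> : - s = - (s / n%:R) * n%:R by field.
    rewrite expRM_natr lerXn2r// ?nnegrE ?expR_ge0 ?(ltW x0)//.
    exact: expR_ge1Dx.
  have -> : - (s / (1 - s / n%:R)) = - (s / n%:R / (1 - s / n%:R)) * n%:R.
    by field; rewrite n_neq0 subr_eq0 gt_eqF.
  rewrite expRM_natr lerXn2r// ?nnegrE ?expR_ge0 ?(ltW x0)//.
  rewrite expRN -[leRHS]invrK lef_pV2 ?posrE ?expR_gt0 ?invr_gt0//.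
  apply: le_trans (expR_ge1Dx _).
  by rewrite le_eqVlt; apply/orP; left; apply/eqP; field; rewrite n_neq0 subr_eq0 gt_eqF.
- apply: (@cvg_comp _ _ _ _ expR _ (nbhs (- s))); last exact: continuous_expR.
  apply: cvgN; rewrite -[X in _ --> X]divr1; apply: cvgM; first exact: cvg_cst.
  apply: cvgV; rewrite ?oner_neq0// -[X in _ --> X]subr0.
  apply: cvgB; first exact: cvg_cst.
  rewrite -[X in _ --> X](mulr0 s); apply: cvgM; first exact: cvg_cst.
  apply/gtr0_cvgV0; first by near=> n; rewrite ltr0n; near: n; exists 1%N.
  exact: cvgr_idn.
- exact: cvg_cst.
Unshelve. all: by end_near. Qed.

(** * Convergence and positivity of the Gamma integral *)

(** The integrand may blow up at 0, so the primitive [t^b / b] is used on compact intervals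
    exhausting []0, 1]], followed by monotone convergence. *)
Lemma ge0_integral_powR_itv01 (R : realType) (b : R) : 0 < b ->
  (\int[lebesgue_measure]_(t in `]0%R, 1%R]) (t `^ (b - 1))%:E <= b^-1%:E)%E.
Proof.
move=> b0.
(* Starting at 2 keeps the left endpoint strictly below 1, as the fundamental theorem of calculus
   requires. *)
pose F (n : nat) : set R := `[n.+2%:R^-1, 1]%classic.
have FE : `]0, 1]%classic = \bigcup_n F n.
  apply/seteqP; split => [t|t [n _]]; rewrite /F/= !in_itv/= => /andP[t0 t1].
    exists (Num.truncn t^-1) => //=; rewrite in_itv/= t1 andbT.
    rewrite -[leRHS]invrK lef_pV2 ?posrE ?ltr0n ?invr_gt0//.
    apply: ltW; apply: lt_le_trans (truncnS_gt _) _; rewrite ler_nat//.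
  by rewrite t1 andbT (lt_le_trans _ t0)// invr_gt0 ltr0n.
have mp : measurable_fun [set: R] (fun t : R => (t `^ (b - 1))%:E).
  by apply/measurable_EFinP; exact: measurable_powR.
have /cvg_lim <- // : (\int[lebesgue_measure]_(t in F n) (t `^ (b - 1))%:E @[n --> \oo] -->
    \int[lebesgue_measure]_(t in `]0%R, 1%R]) (t `^ (b - 1))%:E)%E.
  rewrite FE; apply: ge0_nondecreasing_set_cvg_integral.
  - apply/nondecreasing_seqP => n; apply/subsetPset; apply: subset_itvr.
    by rewrite bnd_simp lef_pV2 ?posrE ?ltr0n// ler_nat.
  - by move=> n; exact: measurable_itv.
  - by move=> n; exact: measurable_funTS.
  - by move=> n t _; rewrite lee_fin powR_ge0.
apply: lime_le.
  apply: ereal_nondecreasing_is_cvgn; apply/nondecreasing_seqP => n.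
  apply: ge0_subset_integral => //; try exact: measurable_itv.
  - exact: measurable_funTS.
  - by move=> t _; rewrite lee_fin powR_ge0.
  - by apply: subset_itvr; rewrite bnd_simp lef_pV2 ?posrE ?ltr0n// ler_nat.
apply: nearW => n; rewrite /F.
have e0 : (0 : R) < n.+2%:R^-1 by rewrite invr_gt0 ltr0n.
have cpowR (c x : R) : 0 < x -> {for x, continuous (fun t : R => t `^ c)}.
  move=> x0; apply: differentiable_continuous; apply/derivable1_diffP.
  by apply: derivable_powR; rewrite in_itv/= x0.
have dpowR (x : R) : 0 < x -> is_derive x 1 (fun t : R => b^-1 * t `^ b) (x `^ (b - 1)).
  move=> x0; have -> : x `^ (b - 1) = b^-1 *: (b * x `^ (b - 1)).
    by rewrite /GRing.scale/= mulKf ?gt_eqF.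
  by apply: is_deriveZ; exact: is_derive1_powR.
rewrite (@continuous_FTC2 _ _ (fun t : R => b^-1 * t `^ b)).
- by rewrite -EFinB lee_fin powR1 mulr1 gerBl mulr_ge0 ?powR_ge0// invr_ge0 ltW.
- by rewrite invf_lt1 ?ltr0n// ltr1n.
- apply: continuous_in_subspaceT => x /[!inE]/=; rewrite in_itv/= => /andP[ex _].
  by apply: cpowR; exact: lt_le_trans ex.
- split.
  + move=> x; rewrite in_itv/= => /andP[ex _].
    by apply: ex_derive; apply: dpowR; exact: lt_trans ex.
  + by apply: cvg_at_right_filter; apply: cvgM; [exact: cvg_cst|exact: cpowR].
  + by apply: cvg_at_left_filter; apply: cvgM; [exact: cvg_cst|exact: cpowR].
- move=> x; rewrite in_itv/= => /andP[ex _]; rewrite derive1E.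
  by apply: derive_val; apply: dpowR; exact: lt_trans ex.
Qed.

Lemma measurable_Gamma_integrand (R : realType) (b : R) (D : set R) :
  measurable_fun D (fun t => t `^ (b - 1) * expR (- t)).
Proof.
apply: measurable_funTS; apply: measurable_funM; first exact: measurable_powR.
by apply: measurableT_comp.
Qed.

(** Cut at 1. Below, [e^(-t) <= 1] leaves an integrable power; above, [t^(b-1) <= t^b <= C e^(t/2)]
    leaves a multiple of the exponential density of rate 1/2. *)
Lemma integrable_Gamma_integrand (R : realType) (b : R) : 0 < b ->
  lebesgue_measure.-integrable `]0, +oo[
    (fun t => (t `^ (b - 1) * expR (- t))%:E).
Proof.
move=> b0.
have f0 (t : R) : (0 <= (t `^ (b - 1) * expR (- t))%:E)%E.
  by rewrite lee_fin mulr_ge0 ?powR_ge0 ?expR_ge0.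
have mf (D : set R) : measurable_fun D (fun t : R => (t `^ (b - 1) * expR (- t))%:E).
  by apply/measurable_EFinP; exact: measurable_Gamma_integrand.
apply/integrableP; split; first exact: mf.
under eq_integral do rewrite gee0_abs//.
rewrite (@itv_bndbnd_setU _ _ _ (BRight 1)) ?bnd_simp//.
rewrite ge0_integral_setU//=; [|exact: mf|]; last first.
  by apply/disj_setPS => t /=; rewrite !in_itv/= andbT => -[/andP[_ t1]]; rewrite ltNge t1.
apply: lte_add_pinfty.
  apply: le_lt_trans (ltry b^-1); apply: le_trans (ge0_integral_powR_itv01 b0).
  apply: ge0_le_integral => //.
  - exact: mf.
  - by apply/measurable_funTS/measurable_EFinP; exact: measurable_powR.
  - move=> t /=; rewrite in_itv/= => /andP[t0 _]; rewrite lee_fin.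
    by rewrite ler_piMr ?powR_ge0// -expR0 ler_expR oppr_le0 ltW.
(* The constant of [powR_le_expR] for [c = 1/2]; the factor 2 next to it below cancels the rate 1/2
   in front of the density. *)
pose C : R := (b / 2^-1) `^ b.
have mE : measurable_fun setT (EFin \o exponential_pdf (2^-1 : R)).
  by apply/measurable_EFinP; exact: measurable_exponential_pdf.
have E0 (t : R) : (0 <= (EFin \o exponential_pdf (2^-1 : R)) t)%E.
  by rewrite lee_fin exponential_pdf_ge0.
apply: (@le_lt_trans _ _
    (\int[lebesgue_measure]_(t in `]1%R, +oo[) ((C * 2)%:E * (EFin \o exponential_pdf (2^-1 : R)) t))%E).
  apply: ge0_le_integral => //.
  - exact: mf.
  - by apply: measurable_funeM; exact: measurable_funTS mE.
  - move=> t /=; rewrite in_itv/= andbT => t1; have t0 : 0 < t by exact: lt_trans t1.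
    rewrite lee_fin exponential_pdfE ?(ltW t0)//.
    have -> : C * 2 * (2^-1 * expR (- 2^-1 * t)) = C * expR (2^-1 * t) * expR (- t).
      rewrite -mulrA (mulrA 2) divff// mul1r -mulrA -expRD.
      by congr (_ * expR _); field.
    rewrite ler_pM2r ?expR_gt0//.
    apply: (@le_trans _ _ (t `^ b)); first by apply: ler_powR; [exact: ltW|lra].
    by apply: powR_le_expR.
rewrite ge0_integralZl//; last 2 first.
- exact: measurable_funTS mE.
- by rewrite lee_fin mulr_ge0 ?powR_ge0.
apply: lte_mul_pinfty => //; first by rewrite lee_fin mulr_ge0 ?powR_ge0.
apply: (@le_lt_trans _ _ (\int[lebesgue_measure]_t (EFin \o exponential_pdf (2^-1 : R)) t)%E).
  exact: ge0_subset_integral.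
by rewrite integral_exponential_pdf// ltry.
Qed.

Lemma Gamma_EFin (R : realType) (b : R) : 0 < b ->
  ((Gamma b)%:E = \int[lebesgue_measure]_(t in `]0%R, +oo[)
    (t `^ (b - 1) * expR (- t))%:E)%E.
Proof.
move=> b0; rewrite /Gamma /Rintegral fineK//.
exact: integrable_fin_num (integrable_Gamma_integrand b0).
Qed.

(** On [1, 2] the exponent [b - 1] is above [-1], so the integrand is at least [t^(-1) e^(-2)],
    hence at least [e^(-2) / 2]. *)
Lemma Gamma_gt0 (R : realType) (b : R) : 0 < b -> 0 < Gamma b.
Proof.
move=> b0; rewrite -lte_fin Gamma_EFin//.
have mf (D : set R) : measurable_fun D (fun t : R => (t `^ (b - 1) * expR (- t))%:E).
  by apply/measurable_EFinP; exact: measurable_Gamma_integrand.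
have f0 (t : R) : (0 <= (t `^ (b - 1) * expR (- t))%:E)%E.
  by rewrite lee_fin mulr_ge0 ?powR_ge0 ?expR_ge0.
apply: (@lt_le_trans _ _ (\int[lebesgue_measure]_(t in `[1%R, 2%R]) (2^-1 * expR (- 2))%:E)%E).
  rewrite integral_cst//= lebesgue_measure_itv/= lte_fin ltr1n/= -EFinB -EFinM lte_fin.
  by rewrite !mulr_gt0 ?expR_gt0//; lra.
apply: (@le_trans _ _ (\int[lebesgue_measure]_(t in `[1%R, 2%R]) (t `^ (b - 1) * expR (- t))%:E)%E).
  apply: ge0_le_integral => //; first exact: mf.
  move=> t /=; rewrite in_itv/= => /andP[t1 t2]; rewrite lee_fin.
  have t0 : 0 < t by exact: lt_le_trans t1.
  apply: ler_pM => //; last by rewrite ler_expR lerN2.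
  apply: (@le_trans _ _ (t `^ (- 1))); last by apply: ler_powR => //; lra.
  by rewrite powR_inv1 ?(ltW t0)// lef_pV2 ?posrE.
apply: ge0_subset_integral => //; first exact: mf.
by move=> t /=; rewrite !in_itv/= andbT => /andP[t1 _]; exact: lt_le_trans t1.
Qed.

(** * The rescaled integrand near x = 1 and its dominated convergence *)

Lemma equiv_at_left1 (R : realType) (g F : R -> R) : g ~_(1^'-) F ->
  forall e : R, 0 < e -> exists2 d : R, 0 < d &
    forall x : R, 1 - d < x < 1 -> `|g x - F x| <= e * `|F x|.
Proof.
move=> /eqaddoP gF e e0; have [d /= d0 dP] := gF _ e0.
exists d => // x /andP[dx x1]; apply: dP => //=.
by rewrite ger0_norm ?subr_ge0 ?(ltW x1)//; lra.
Qed.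

(* [n^b x^n g(x) dx] in the variable [s = n (1 - x)], cut at [x = 1 - d]. *)
Definition rescaled (R : realType) (g : R -> R) (b d : R) (n : nat) : R -> R :=
  (fun s => (1 - s / n%:R) ^+ n * (n%:R `^ (b - 1) * g (1 - s / n%:R)))
    \_ `]0, n%:R * d[.

Section rescaled.
Context (R : realType) (g : R -> R) (c b d : R).
Hypotheses (c0 : 0 < c) (b0 : 0 < b) (d0 : 0 < d) (d1 : d <= 1).
Hypothesis mg : measurable_fun (`[0, 1] : set R) g.
Hypothesis g0 : forall x : R, x \in `[0, 1] -> 0 <= g x.
Hypothesis gF : g ~_(1^'-) (fun x => c * (1 - x) `^ (b - 1)).
Hypothesis gd : forall x : R, 1 - d < x < 1 -> g x <= 2 * (c * (1 - x) `^ (b - 1)).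

Let onem_div (n : nat) (s e : R) : 0 < s -> s < n%:R * e ->
  1 - e < 1 - s / n%:R < 1.
Proof.
(* For [n = 0] the two bounds on [s] contradict each other, so the default value of [s / 0] does not
   matter. *)
move=> s0; case: n => [|n sn]; first by rewrite mul0r ltNge (ltW s0).
have n0 : (0 : R) < n.+1%:R by rewrite ltr0n.
have : 0 < s / n.+1%:R by rewrite divr_gt0.
have : s / n.+1%:R < e by rewrite ltr_pdivrMr// mulrC.
by move: (s / n.+1%:R) => t ? ?; apply/andP; split; lra.
Qed.

Lemma measurable_rescaled n (D : set R) :
  measurable D -> measurable_fun D (rescaled g b d n).
Proof.
move=> mD; apply: measurable_funTS; apply/measurable_restrict => //; rewrite setTI.
have maff : measurable_fun [set: R] (fun s : R => 1 - s / n%:R).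
  by apply: measurable_funB => //; exact: mulrr_measurable.
apply: measurable_funM; first exact/measurable_funTS/measurable_funX.
apply: measurable_funM => //.
apply: (measurable_comp _ _ mg) => //; last exact: measurable_funTS.
move=> _ [s /= + <-]; rewrite !in_itv/= => /andP[s0 sn].
have /andP[dx x1] := onem_div s0 sn.
by rewrite (ltW x1) andbT (le_trans _ (ltW dx)) ?subr_ge0.
Qed.

Lemma rescaled_ge0 n s : 0 < s -> 0 <= rescaled g b d n s.
Proof.
move=> s0; rewrite /rescaled patchE; case: ifPn => // /[!inE]/=.
rewrite in_itv/= => /andP[_ sn]; have /andP[dx x1] := onem_div s0 sn.
have x0 : 0 <= 1 - s / n%:R by rewrite (le_trans _ (ltW dx)) ?subr_ge0.
by rewrite !mulr_ge0 ?powR_ge0 ?exprn_ge0// g0// in_itv/= x0 ltW.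
Qed.

(** [(1 - s / n)^n <= e^(-s)], and [gd] bounds the other factor by [2 c s^(b-1)] because
    [n^(b-1) (s / n)^(b-1) = s^(b-1)]. *)
Lemma rescaled_bound n s : 0 < s ->
  `|rescaled g b d n s| <= 2 * c * (s `^ (b - 1) * expR (- s)).
Proof.
move=> s0; rewrite ger0_norm ?rescaled_ge0// /rescaled patchE.
case: ifPn => [|_]; last by rewrite !mulr_ge0 ?powR_ge0 ?expR_ge0// ltW.
rewrite inE/= in_itv/= s0/= => sn.
have xd := onem_div s0 sn; have /andP[dx x1] := xd.
have n0 : (0 : R) < n%:R.
  by case: n sn {xd dx x1} => [|n _]; rewrite ?ltr0n// mul0r ltNge (ltW s0).
have x0 : 0 <= 1 - s / n%:R by rewrite (le_trans _ (ltW dx)) ?subr_ge0.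
have -> : 2 * c * (s `^ (b - 1) * expR (- s)) = expR (- s) * (2 * c * s `^ (b - 1)) by ring.
apply: ler_pM.
- by rewrite exprn_ge0.
- by rewrite mulr_ge0 ?powR_ge0// g0// in_itv/= x0 ltW.
- have -> : - s = - (s / n%:R) * n%:R by field; rewrite gt_eqF.
  by rewrite expRM_natr lerXn2r// ?nnegrE ?expR_ge0//; exact: expR_ge1Dx.
- apply: (le_trans (ler_wpM2l (powR_ge0 _ _) (gd xd))).
  rewrite subKr; have -> : n%:R `^ (b - 1) * (2 * (c * (s / n%:R) `^ (b - 1)))
    = 2 * c * (n%:R `^ (b - 1) * (s / n%:R) `^ (b - 1)) by ring.
  rewrite ler_pM2l ?mulr_gt0//.
  by rewrite -powRM ?(ltW n0) ?divr_ge0 ?(ltW n0) ?(ltW s0)// mulrC divfK// gt_eqF.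
Qed.

(** For fixed [s] the cut is eventually inactive, and [1 - s / n] tends to 1 from the left, where
    the equivalent of [g] applies. *)
Lemma cvg_rescaled s : 0 < s ->
  rescaled g b d n s @[n --> \oo] --> c * (s `^ (b - 1) * expR (- s)).
Proof.
move=> s0; rewrite (mulrC (s `^ _)) mulrCA.
have near_s e : 0 < e -> \forall n \near \oo, s < n%:R * e.
  by move=> e0; near=> n; rewrite -ltr_pdivrMr//; near: n; exact: nbhs_infty_gtr.
apply: (@cvg_trans _ ((1 - s / n%:R) ^+ n * (n%:R `^ (b - 1) * g (1 - s / n%:R)) @[n --> \oo])).
  apply: near_eq_cvg; near=> n; rewrite /rescaled patchE ifT// inE/= in_itv/= s0/=.
  by near: n; exact: near_s.
apply: cvgM; first exact: cvg_onem_exprn.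
apply/cvgrPdist_le => e e0.
have L0 : 0 < c * s `^ (b - 1) by rewrite mulr_gt0// powR_gt0.
(* A relative error [e / (c s^(b-1))] on [g] becomes the absolute error [e] after multiplication by
   [n^(b-1)]. *)
have [d' d'0 Hd'] := equiv_at_left1 gF (divr_gt0 e0 L0).
near=> n.
have n0 : (0 : R) < n%:R by rewrite ltr0n; near: n; exists 1%N.
have /Hd' : 1 - d' < 1 - s / n%:R < 1 by apply: onem_div => //; near: n; exact: near_s.
rewrite subKr (@ger0_norm _ (c * _)) ?mulr_ge0 ?powR_ge0 ?(ltW c0)// => H.
have sE : s `^ (b - 1) = n%:R `^ (b - 1) * (s / n%:R) `^ (b - 1).
  by rewrite -powRM ?(ltW n0) ?divr_ge0 ?(ltW n0) ?(ltW s0)// mulrC divfK// gt_eqF.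
rewrite {1}sE mulrCA -mulrBr normrM (ger0_norm (powR_ge0 _ _)) distrC.
apply: (le_trans (ler_wpM2l (powR_ge0 _ _) H)).
have -> : n%:R `^ (b - 1) * (e / (c * s `^ (b - 1)) * (c * (s / n%:R) `^ (b - 1)))
  = e / (c * s `^ (b - 1)) * (c * (n%:R `^ (b - 1) * (s / n%:R) `^ (b - 1))) by ring.
by rewrite -sE divfK// gt_eqF.
Unshelve. all: by end_near. Qed.

Lemma cvg_integral_rescaled :
  (\int[lebesgue_measure]_(s in `]0%R, +oo[) (rescaled g b d n s)%:E
     @[n --> \oo] --> (c * Gamma b)%:E)%E.
Proof.
have -> : (c * Gamma b)%:E =
    (\int[lebesgue_measure]_(s in `]0%R, +oo[) (c%:E * (s `^ (b - 1) * expR (- s))%:E))%E.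
  rewrite EFinM Gamma_EFin// integralZl//.
  exact: integrable_Gamma_integrand.
have [] // := @dominated_convergence _ _ _ (@lebesgue_measure R) `]0%R, +oo[%classic _
  (fun n s => (rescaled g b d n s)%:E) (fun s => c%:E * (s `^ (b - 1) * expR (- s))%:E)%E
  (fun s => (2 * c)%:E * (s `^ (b - 1) * expR (- s))%:E)%E.
- by move=> n; apply/measurable_EFinP; exact: measurable_rescaled.
- apply: measurable_funeM; apply/measurable_EFinP; exact: measurable_Gamma_integrand.
- apply: aeW => s /=; rewrite in_itv/= andbT => s0.
  by apply: cvg_EFin; [exact: nearW|exact: cvg_rescaled].
- by apply: integrableZl => //; exact: integrable_Gamma_integrand.
- apply: aeW => s n /=; rewrite in_itv/= andbT => s0.
  by rewrite -EFinM lee_fin; exact: rescaled_bound.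
Qed.

(** Substitution [x = 1 - s / n]: its Jacobian [1 / n] lowers [n^b] to the power [n^(b-1)] built
    into [rescaled]. *)
Lemma integral_rescaled n : (0 < n)%N ->
  ((n%:R `^ b)%:E * \int[lebesgue_measure]_(x in `](1 - d)%R, 1%R[) (x ^+ n * g x)%:E =
   \int[lebesgue_measure]_(s in `]0%R, +oo[) (rescaled g b d n s)%:E)%E.
Proof.
move=> n_gt0; have n0 : (0 : R) < n%:R by rewrite ltr0n.
have mxg : measurable_fun (`]1 - d, 1[ : set R) (fun x => x ^+ n * g x).
  apply: measurable_funM; first exact/measurable_funTS/measurable_funX.
  apply: measurable_funS mg => // x /=; rewrite !in_itv/= => /andP[dx x1].
  by rewrite (ltW x1) andbT (le_trans _ (ltW dx)) ?subr_ge0.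
rewrite (@ge0_integral_onemM _ n%:R^-1) ?invr_gt0//; last 2 first.
- exact/measurable_EFinP.
- move=> x /=; rewrite in_itv/= => /andP[dx x1].
  have x0 : 0 <= x by rewrite (le_trans _ (ltW dx)) ?subr_ge0.
  by rewrite lee_fin mulr_ge0 ?exprn_ge0// g0// in_itv/= x0 ltW.
rewrite muleA -EFinM.
(* The preimage is written as an intersection so that the cut can move from the domain into the
   integrand. *)
have -> : [set s : R | `](1 - d)%R, 1%R[%classic (1 - n%:R^-1 * s)] =
    `]0, +oo[%classic `&` `]0, n%:R * d[%classic.
  rewrite setIidr; last by move=> s /=; rewrite !in_itv/= andbT => /andP[].
  apply/seteqP; split => s /=; rewrite !in_itv/= (mulrC _ s).
    rewrite ltrD2l ltrN2 gtrBl ltr_pdivrMr// pmulr_lgt0 ?invr_gt0// (mulrC d).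
    by move=> /andP[-> ->].
  by move=> /andP[s0 sn]; exact: onem_div.
rewrite integral_mkcondr.
have K0 : 0 < n%:R `^ b / n%:R :> R by rewrite divr_gt0// powR_gt0.
rewrite (eq_integral (fun s : measurableTypeR R => ((n%:R `^ b / n%:R)^-1)%:E * (rescaled g b d n s)%:E)%E).
  rewrite ge0_integralZl//.
  - by rewrite muleA -EFinM divff ?mul1e// gt_eqF.
  - by apply/measurable_EFinP; exact: measurable_rescaled.
  - by move=> s /=; rewrite in_itv/= andbT => s0; rewrite lee_fin rescaled_ge0.
move=> s _; rewrite /rescaled !patchE; case: ifPn => _; last by rewrite mule0.
rewrite -EFinM (mulrC _ s).
congr EFin; rewrite mulrCA; congr (_ * _); rewrite mulrA.
rewrite -(mulr_powRB1 (ltW n0) b0) (mulrC n%:R) mulfK ?gt_eqF// mulVf ?mul1r//.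
by rewrite gt_eqF// powR_gt0.
Qed.

End rescaled.

(** * Asymptotics of the moments *)

Section moment.
Context (R : realType) (G : probability R R) (g : R -> R) (c b : R).
Hypotheses (c0 : 0 < c) (b0 : 0 < b) (G01 : G `[0, 1]%classic = 1%E).
Hypothesis Gg : density01 G g.
Hypothesis gF : g ~_(1^'-) (fun x => c * (1 - x) `^ (b - 1)).

Let mX n (D : set R) : measurable_fun D (fun x => (x ^+ n)%:E).
Proof. by apply/measurable_EFinP/measurable_funTS; exact: measurable_funX. Qed.

Lemma moment_fin_num n : (\int[G]_(x in `[0%R, 1%R]) (x ^+ n)%:E)%E \is a fin_num.
Proof.
rewrite ge0_fin_numE; last first.
  by apply: integral_ge0 => x /=; rewrite in_itv/= => /andP[x0 _]; rewrite lee_fin exprn_ge0.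
apply: (@le_lt_trans _ _ (\int[G]_(x in `[0%R, 1%R]) (cst 1%E x))%E); last first.
  by rewrite integral_cst// mul1e (le_lt_trans (probability_le1 _ _)) ?ltry.
apply: ge0_le_integral => //.
- by move=> x /=; rewrite in_itv/= => /andP[x0 _]; rewrite lee_fin exprn_ge0.
- by move=> x /=; rewrite in_itv/= => /andP[x0 x1]; rewrite lee_fin exprn_ile1.
Qed.

(* The mass of [0, 1 - d] contributes at most n^b (1 - d)^n -> 0; on ]1 - d, 1]
   the substitution x = 1 - s / n turns n^b x^n g(x) dx into the integrand
   [rescaled], which converges dominatedly. *)
Lemma cvg_moment :
  n%:R `^ b * \int[G]_(x in `[0, 1]) (x ^+ n) @[n --> \oo] --> c * Gamma b.
Proof.
have [mg g0 _] := Gg.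
have [d' d'0 Hd'] := equiv_at_left1 gF ltr01.
pose d : R := Num.min d' 1.
have d0 : 0 < d by rewrite lt_min d'0 ltr01.
have d1 : d <= 1 by rewrite ge_min lexx orbT.
(* The equivalence taken with relative error 1 gives the factor 2. *)
have gd (x : R) : 1 - d < x < 1 -> g x <= 2 * (c * (1 - x) `^ (b - 1)).
  move=> /andP[dx x1]; have /Hd' : 1 - d' < x < 1.
    by rewrite x1 andbT (le_lt_trans _ dx)// lerD2l lerN2 ge_min lexx.
  rewrite mul1r (@ger0_norm _ (c * _)) ?mulr_ge0 ?powR_ge0 ?(ltW c0)// => H.
  by rewrite mulr_natl mulr2n -lerBlDr (le_trans (ler_norm _)).
have split_moment n :
    (\int[G]_(x in `[0%R, 1%R]) (x ^+ n)%:E =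
     \int[G]_(x in `[0%R, (1 - d)%R]) (x ^+ n)%:E +
     \int[lebesgue_measure]_(x in `](1 - d)%R, 1%R[) (x ^+ n * g x)%:E)%E.
  rewrite (@itv_bndbnd_setU _ _ _ (BRight (1 - d))) ?bnd_simp ?subr_ge0 ?gerBl ?(ltW d0)//.
  rewrite ge0_integral_setU//=; last 2 first.
  - move=> x [] /=; rewrite in_itv/= => /andP[x_ge _]; rewrite lee_fin exprn_ge0//.
    by rewrite (le_trans _ (ltW x_ge)) ?subr_ge0.
  - apply/disj_setPS => x /=; rewrite !in_itv/= => -[/andP[_ xd] /andP[]].
    by rewrite ltNge xd.
  congr (_ + _)%E.
  rewrite (ge0_integral_density01 Gg G01)//; last 2 first.
  - move=> x /=; rewrite !in_itv/= => /andP[dx ->]; rewrite andbT.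
    by rewrite (le_trans _ (ltW dx)) ?subr_ge0.
  - move=> x /=; rewrite in_itv/= => /andP[dx _]; rewrite lee_fin exprn_ge0//.
    by rewrite (le_trans _ (ltW dx)) ?subr_ge0.
  under eq_integral do rewrite -EFinM.
  (* The endpoint 1 is Lebesgue-null; removing it leaves the open interval on which [g] is
     controlled. *)
  rewrite -integral_itv_bndo_bndc//.
  apply/measurable_EFinP; apply: measurable_funM.
    by apply/measurable_funTS; exact: measurable_funX.
  apply: measurable_funS mg => // x /=; rewrite !in_itv/= => /andP[dx x1].
  by rewrite (ltW x1) andbT (le_trans _ (ltW dx)) ?subr_ge0.
suff: ((n%:R `^ b)%:E * \int[G]_(x in `[0%R, 1%R]) (x ^+ n)%:E @[n --> \oo] --> (c * Gamma b)%:E)%E.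
  move=> /fine_cvg; apply: cvg_trans; apply: near_eq_cvg; near=> n => /=.
  by rewrite fineM// moment_fin_num.
rewrite -[(c * Gamma b)%:E]add0e.
apply: (@cvg_trans _ ((n%:R `^ b)%:E * \int[G]_(x in `[0%R, (1 - d)%R]) (x ^+ n)%:E +
   \int[lebesgue_measure]_(s in `]0%R, +oo[) (rescaled g b d n s)%:E @[n --> \oo])%E).
  apply: near_eq_cvg; near=> n.
  have n_gt0 : (0 < n)%N by near: n; exists 1%N.
  rewrite split_moment -(integral_rescaled b0 d1 mg g0)//; apply/esym/ge0_muleDr.
  - apply: integral_ge0 => x /=; rewrite in_itv/= => /andP[x_ge0 _].
    by rewrite lee_fin exprn_ge0.
  - apply: integral_ge0 => x /=; rewrite in_itv/= => /andP[dx x1].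
    have x_ge0 : 0 <= x by rewrite (le_trans _ (ltW dx)) ?subr_ge0.
    by rewrite lee_fin mulr_ge0 ?exprn_ge0// g0// in_itv/= x_ge0 ltW.
apply: cvgeD => //; last exact: cvg_integral_rescaled.
apply: (@squeeze_cvge _ _ _ _ (cst 0%E) _ (fun n => (n%:R `^ b * (1 - d) ^+ n)%:E)).
- near=> n; apply/andP; split.
    rewrite mule_ge0 ?lee_fin ?powR_ge0//; apply: integral_ge0 => x /=.
    by rewrite in_itv/= => /andP[x_ge0 _]; rewrite lee_fin exprn_ge0.
  rewrite EFinM lee_pmul2l// ?lte_fin ?powR_gt0//; last first.
    by rewrite ltr0n; near: n; exists 1%N.
  apply: (@le_trans _ _ (\int[G]_(x in `[0%R, (1 - d)%R]) (cst ((1 - d) ^+ n)%:E x))%E).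
    apply: ge0_le_integral => //.
    + by move=> x /=; rewrite in_itv/= => /andP[x_ge0 _]; rewrite lee_fin exprn_ge0.
    + move=> x /=; rewrite in_itv/= => /andP[x_ge0 xd].
      by rewrite lee_fin lerXn2r// nnegrE (le_trans x_ge0).
  rewrite integral_cst// -[leRHS]mule1; apply: lee_wpmul2l; last exact: probability_le1.
  by rewrite lee_fin exprn_ge0 ?subr_ge0.
- exact: cvg_cst.
- apply: cvg_EFin; first exact: nearW.
  by apply: cvg_powR_geometric => //; rewrite subr_ge0 d1 gtrBl d0.
Unshelve. all: by end_near. Qed.
End moment.

(** * The posterior as a ratio of moments *)

(** Serves both truth values: [E] is the event fixing the label, [X] the latent rate on it, and [A]
    the event that all gates accept. Given the rate [x], the verdicts contribute [x^k]. *)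
Lemma joint_accept_prob (d : measure_display) (T : measurableType d)
    (R : realType) (P : probability T R) (X : {RV P >-> R}) (E A : set T)
    (p : R) (nu : probability R R) (k : nat) :
  0 < p -> measurable E -> measurable A -> P E = p%:E ->
  nu `[0, 1]%classic = 1%E ->
  (forall B : set R, measurable B ->
    cond_prob P (X @^-1` B) E = fine (nu B)) ->
  (forall B : set R, measurable B ->
    P (E `&` X @^-1` B `&` A) =
    (\int[P]_(w in E `&` X @^-1` B) (\prod_(i < k) verdict_prob (X w) true)%:E)%E) ->
  fine (P (E `&` A)) = p * \int[nu]_(x in `[0, 1]) (x ^+ k).
Proof.
move=> p0 mE mA PE nu01 law verdicts.
have mX B : measurable B -> measurable (X @^-1` B).
  by move=> mB; rewrite -(setTI (_ @^-1` _)); exact: measurable_funP.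
(* [cond_prob] is a real quotient; [p <> 0] and finiteness of the measures recover the extended-real
   product. *)
have PEX B : measurable B -> (P (E `&` X @^-1` B) = p%:E * nu B)%E.
  move=> mB; have := law _ mB; rewrite /cond_prob PE/= => /(canRL (mulfVK _)).
  rewrite gt_eqF// => /(_ isT) h.
  rewrite setIC -[LHS]fineK ?fin_num_measure//; last first.
    by apply: measurableI => //; exact: mX.
  by rewrite h mulrC EFinM fineK// fin_num_measure.
(* Rates outside [0, 1] have probability zero on [E]. Discarding them first makes [x^k] nonnegative
   on the domain of integration. *)
have -> : P (E `&` A) = P (E `&` X @^-1` `[0, 1]%classic `&` A).
  rewrite [RHS](_ : _ = P ((E `&` A) `&` X @^-1` `[0, 1]%classic)); last by rewrite setIAC.
  rewrite -[in LHS](setIT (E `&` A)) -(setUv (X @^-1` `[0, 1]%classic)) setIUr measureU//=; last 3 first.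
  - by do 2?apply: measurableI => //; exact: mX.
  - by do 2?apply: measurableI => //; apply: measurableC; exact: mX.
  - by rewrite setIACA setICr setI0.
  rewrite [X in (_ + X)%E](_ : _ = 0%E) ?adde0//.
  apply/eqP; rewrite -measure_le0.
  apply: (@le_trans _ _ (P (E `&` X @^-1` (~` `[0, 1]%classic)))).
    apply: le_measure; rewrite ?inE/=.
    - by do 2?apply: measurableI => //; apply: measurableC; exact: mX.
    - by apply: measurableI => //; apply: mX; exact: measurableC.
    - by move=> w [[]].
  rewrite PEX; last exact: measurableC.
  by rewrite probability_setC// nu01 subee// mule0.
rewrite verdicts//.
under eq_integral do rewrite big_const_ord iter_mulr_1.
rewrite (@ge0_integral_conditional_law _ _ _ P X E p nu _ (fun x => (x ^+ k)%:E) (ltW p0))//; last 2 first.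
- by apply/measurable_EFinP/measurable_funTS; exact: measurable_funX.
- by move=> x /=; rewrite in_itv/= => /andP[x0 _]; rewrite lee_fin exprn_ge0.
by rewrite /Rintegral fineM// moment_fin_num.
Qed.

(** Bayes' rule: [u] and [v] are the probabilities of acceptance by all gates jointly with each
    label, and the two labels partition the space. *)
Lemma posteriorE (R : realType) (p0 : R) (G H : probability R R) (k : nat)
    (M : cascade p0 G H k) :
  0 < p0 < 1 -> G `[0, 1]%classic = 1%E -> H `[0, 1]%classic = 1%E ->
  let u := p0 * \int[H]_(x in `[0, 1]) (x ^+ k) in
  let v := (1 - p0) * \int[G]_(x in `[0, 1]) (x ^+ k) in
  posterior M = u / (u + v).
Proof.
move=> /andP[p0_gt0 p0_lt1] G01 H01 u v.
set A := [set w | forall i, cas_V M i w = true].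
have mpre (X : {RV (cas_P M) >-> bool}) b : measurable (X @^-1` [set b]).
  by rewrite -(setTI (_ @^-1` _)); exact: measurable_funP.
have mA : measurable A.
  have -> : A = \bigcap_(i in [set: 'I_k]) (cas_V M i @^-1` [set true]).
    by apply/seteqP; split => w /= h i; [move=> _|]; exact: h.
  by apply: fin_bigcap_measurable => // i _; exact: mpre.
have CE : cas_C M @^-1` [set false] = ~` (cas_C M @^-1` [set true]).
  by apply/seteqP; split => w /=; case: (cas_C M w).
have uE : fine (cas_P M (cas_C M @^-1` [set true] `&` A)) = u.
  apply: (@joint_accept_prob _ _ _ (cas_P M) (cas_beta M)) => //.
  - exact: cas_prior.
  - exact: cas_beta_law.
  - by move=> B mB; rewrite (cas_verdicts1 M (fun=> true)).
have vE : fine (cas_P M (cas_C M @^-1` [set false] `&` A)) = v.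
  apply: (@joint_accept_prob _ _ _ (cas_P M) (cas_alpha M)) => //.
  - by rewrite subr_gt0.
  - by rewrite CE probability_setC// cas_prior.
  - exact: cas_alpha_law.
  - by move=> B mB; rewrite (cas_verdicts0 M (fun=> true)).
rewrite /posterior /cond_prob -/A uE; congr (_ / _).
rewrite -uE -vE CE -fineD ?fin_num_measure//; do ?[by apply: measurableI => //; exact: measurableC].
congr fine; rewrite -measureU//; last 3 first.
- exact: measurableI.
- by apply: measurableI => //; exact: measurableC.
- by rewrite setIACA setICr set0I.
by rewrite -setIUl setUv setTI.
Qed.

(** * Logistic function and logarithm *)

Lemma logitK (R : realType) (x : R) : 0 < x < 1 -> sigma (logit x) = x.
Proof.
move=> /andP[x0 x1]; have y0 : 0 < 1 - x by rewrite subr_gt0.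
rewrite /sigma /logit expRN lnK ?posrE ?divr_gt0//.
by field; rewrite !gt_eqF// addrC subrK.
Qed.

Lemma sigma_lt1 (R : realType) (x : R) : sigma x < 1.
Proof.
have e0 := expR_gt0 (- x).
by rewrite /sigma ltr_pdivrMr ?mul1r; lra.
Qed.

Lemma continuous_sigma (R : realType) : continuous (@sigma R).
Proof.
move=> x; have e0 := expR_gt0 (- x).
apply: cvgM; first exact: cvg_cst.
apply: cvgV; first by rewrite gt_eqF// addr_gt0.
apply: cvgD; first exact: cvg_cst.
apply: continuous_comp; first exact: opp_continuous.
exact: continuous_expR.
Qed.

Lemma cvgn_ln (R : realType) : (ln n%:R : R) @[n --> \oo] --> +oo.
Proof.
apply/cvgryPge => A; near=> n.
have An : expR A <= n%:R by near: n; exact: nbhs_infty_ger.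
by rewrite -[A]expRK ler_ln ?posrE ?expR_gt0// (lt_le_trans _ An)// expR_gt0.
Unshelve. all: by end_near. Qed.

(** * The three regimes, for log-odds of the form [e ln n + L + o(1)] *)

Section regimes.
Context (R : realType) (ell r : nat -> R) (e L : R).
Hypothesis ell_cvg : ell n - e * ln n%:R @[n --> \oo] --> L.
Hypothesis r_ell : \forall n \near \oo, r n = sigma (ell n).

Lemma cvg_log_oddsy : 0 < e -> ell n @[n --> \oo] --> +oo.
Proof.
move=> e0; apply/cvgryPge => A; near=> n.
have : L - 1 <= ell n - e * ln n%:R.
  by near: n; apply: (cvgr_ge L ell_cvg); rewrite gtrBl.
have : (A - (L - 1)) / e <= ln n%:R.
  by near: n; move: ((A - _) / e); apply/cvgryPge; exact: cvgn_ln.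
rewrite ler_pdivrMr// mulrC; lra.
Unshelve. all: by end_near. Qed.

Lemma cvg_log_oddsNy : e < 0 -> ell n @[n --> \oo] --> -oo.
Proof.
move=> e0; apply/cvgrNyPle => A; near=> n.
have : ell n - e * ln n%:R <= L + 1.
  by near: n; apply: (cvgr_le L ell_cvg); rewrite ltrDl.
have : (A - (L + 1)) / e <= ln n%:R.
  by near: n; move: ((A - _) / e); apply/cvgryPge; exact: cvgn_ln.
rewrite ler_ndivrMr// mulrC; lra.
Unshelve. all: by end_near. Qed.

(** The quotient equals [1 / (n^(-e) + w)] with [w = exp(ell n - e ln n)]. Eventually [w] lies
    between [exp(L - 1)] and [exp(L + 1)], while [0 < n^(-e) <= 1]; this gives both constants. *)
Lemma asymp_posterior_compl : 0 < e ->
  asymp (fun n => 1 - r n) (fun n => n%:R `^ (- e)).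
Proof.
move=> e0; exists (1 + expR (L + 1))^-1, (expR (L - 1))^-1.
split; rewrite ?invr_gt0 ?addr_gt0 ?expR_gt0//; near=> n.
have n1 : (1 : R) <= n%:R by rewrite ler1n; near: n; exists 1%N.
have n0 : (0 : R) < n%:R by exact: lt_le_trans n1.
have wl : expR (L - 1) <= expR (ell n - e * ln n%:R).
  by rewrite ler_expR; near: n; apply: (cvgr_ge L ell_cvg); rewrite gtrBl.
have wu : expR (ell n - e * ln n%:R) <= expR (L + 1).
  by rewrite ler_expR; near: n; apply: (cvgr_le L ell_cvg); rewrite ltrDl.
have -> : r n = sigma (ell n) by near: n.
have p0 : 0 < n%:R `^ (- e) by rewrite powR_gt0.
have p1 : n%:R `^ (- e) <= 1.
  by rewrite -[leRHS](powRr0 (n%:R : R)); apply: ler_powR => //; rewrite oppr_le0 ltW.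
have pE : expR (ell n) * n%:R `^ (- e) = expR (ell n - e * ln n%:R).
  by rewrite /powR gt_eqF// -expRD mulNr.
have -> : (1 - sigma (ell n)) / n%:R `^ (- e) =
    (n%:R `^ (- e) + expR (ell n - e * ln n%:R))^-1.
  have x0 := expR_gt0 (ell n).
  rewrite -pE /sigma expRN; field.
  by rewrite !gt_eqF ?addr_gt0 ?mulr_gt0.
have w0 := expR_gt0 (L - 1).
by rewrite !lef_pV2 ?posrE ?expR_gt0 ?addr_gt0 ?expR_gt0//; apply/andP; split; lra.
Unshelve. all: by end_near. Qed.

(** Since [sigma x <= e^x], the posterior is below [eps] once the log-odds are below [ln eps]. *)
Lemma cvg_posterior0 : e < 0 -> r n @[n --> \oo] --> 0.
Proof.
move=> e0; have /cvgrNyPle ellNy := cvg_log_oddsNy e0.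
apply/cvgrPdist_le => eps eps0; near=> n; rewrite sub0r normrN.
have -> : r n = sigma (ell n) by near: n.
have x0 := expR_gt0 (- ell n).
rewrite ger0_norm; last by rewrite divr_ge0// addr_ge0 ?expR_ge0.
apply: (@le_trans _ _ (expR (ell n))).
  rewrite /sigma div1r -[leRHS]invrK -expRN lef_pV2 ?posrE ?addr_gt0//; lra.
have : ell n <= ln eps by near: n; exact: ellNy.
by rewrite -ler_expR lnK.
Unshelve. all: by end_near. Qed.

Lemma cvg_posterior_sigma : e = 0 -> r n @[n --> \oo] --> sigma L.
Proof.
move=> e0; apply: (@cvg_trans _ (sigma (ell n - e * ln n%:R) @[n --> \oo])).
  apply: near_eq_cvg; near=> n; rewrite e0 mul0r subr0; apply/esym.
  by near: n.
by apply: continuous_cvg => //; exact: continuous_sigma.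
Unshelve. all: by end_near. Qed.

End regimes.

(** * Expansion of the log-odds and trichotomy *)

Theorem theorem4p1 (R : realType) (p0 : R) (G H : probability R R)
    (g h : R -> R) (ca cb ba bb : R) (M : forall k : nat, cascade p0 G H k)
    (p0_gt0 : 0 < p0) (p0_lt1 : p0 < 1)
    (G01 : G `[0, 1]%classic = 1%E) (H01 : H `[0, 1]%classic = 1%E)
    (G1 : G [set 1] = 0%E) (H1 : H [set 1] = 0%E)
    (Gg : density01 G g) (Hh : density01 H h)
    (ca_gt0 : 0 < ca) (cb_gt0 : 0 < cb) (ba_gt0 : 0 < ba) (bb_gt0 : 0 < bb)
    (g_equiv : g ~_(1^'-) (fun x : R => ca * (1 - x) `^ (ba - 1)))
    (h_equiv : h ~_(1^'-) (fun x : R => cb * (1 - x) `^ (bb - 1))) :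
  let r (k : nat) : R := posterior (M k) in
  let ell (k : nat) : R := log_odds (M k) in
  ell = (fun k : nat => ell 0%N + ln ((cb * Gamma bb) / (ca * Gamma ba))
                        + (ba - bb) * ln k%:R) +o_\oo (fun=> 1 : R)
  /\
  exactly_one3
    [/\ bb < ba, ell @ \oo --> +oo &
        asymp (fun k => 1 - r k) (fun k => k%:R `^ (- (ba - bb)))]
    [/\ ba = bb, r @ \oo --> sigma (ell 0%N + ln (cb / ca)) &
        sigma (ell 0%N + ln (cb / ca)) < 1]
    [/\ ba < bb, ell @ \oo --> -oo & r @ \oo --> 0].
Proof.
move=> r ell.
have p01 : 0 < p0 < 1 by rewrite p0_gt0.
have q0 : 0 < 1 - p0 by rewrite subr_gt0.
pose u k := p0 * \int[H]_(x in `[0, 1]) (x ^+ k).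
pose v k := (1 - p0) * \int[G]_(x in `[0, 1]) (x ^+ k).
have rE k : r k = u k / (u k + v k) by exact: posteriorE.
pose U := p0 * (cb * Gamma bb); pose V := (1 - p0) * (ca * Gamma ba).
have U0 : 0 < U by rewrite !mulr_gt0 ?Gamma_gt0.
have V0 : 0 < V by rewrite !mulr_gt0 ?Gamma_gt0.
have uU : n%:R `^ bb * u n @[n --> \oo] --> U.
  under eq_fun do rewrite mulrCA.
  by apply: cvgM; [exact: cvg_cst|exact: (cvg_moment cb_gt0 bb_gt0 H01 Hh h_equiv)].
have vV : n%:R `^ ba * v n @[n --> \oo] --> V.
  under eq_fun do rewrite mulrCA.
  by apply: cvgM; [exact: cvg_cst|exact: (cvg_moment ca_gt0 ba_gt0 G01 Gg g_equiv)].
have n_gt0 : \forall n \near \oo, (0 : R) < n%:R.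
  by near=> n; rewrite ltr0n; near: n; exists 1%N.
(* Positivity is read off the positive limit [U], hence holds for large [n]; likewise for [v]. It
   places [r n] strictly between 0 and 1, where [sigma] inverts [logit]. *)
have u_gt0 : \forall n \near \oo, 0 < u n.
  near=> n; have : 0 < n%:R `^ bb * u n by near: n; exact: (cvgr_gt U uU).
  by rewrite pmulr_rgt0// powR_gt0//; near: n.
have v_gt0 : \forall n \near \oo, 0 < v n.
  near=> n; have : 0 < n%:R `^ ba * v n by near: n; exact: (cvgr_gt V vV).
  by rewrite pmulr_rgt0// powR_gt0//; near: n.
pose L := ell 0%N + ln (cb * Gamma bb / (ca * Gamma ba)).
(* [ell 0] is the prior log-odds by [log_odds0], so the prior weights and the Gamma constants
   combine into [U / V]. *)
have LE : L = ln U - ln V.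
  rewrite /L /ell log_odds0 /logit /U /V.
  have ? := Gamma_gt0 ba_gt0; have ? := Gamma_gt0 bb_gt0.
  rewrite -ln_div ?posrE ?mulr_gt0// -lnM ?posrE ?divr_gt0 ?mulr_gt0//.
  by congr ln; field; rewrite !gt_eqF.
have r_sigma : \forall n \near \oo, r n = sigma (ell n).
  near=> n; have ? : 0 < u n by near: n.
  have ? : 0 < v n by near: n.
  rewrite /ell /log_odds -/(r n) logitK// rE divr_gt0 ?addr_gt0//=.
  by rewrite ltr_pdivrMr ?addr_gt0// mul1r ltrDl.
have ell_cvg : ell n - (ba - bb) * ln n%:R @[n --> \oo] --> L.
  (* The posterior odds are [u n / v n]; normalizing each moment by its own power of [n] produces
     the term [(ba - bb) ln n]. *)
  apply: (@cvg_trans _ (ln (n%:R `^ bb * u n) - ln (n%:R `^ ba * v n) @[n --> \oo])).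
    apply: near_eq_cvg; near=> n.
    have n0 : (0 : R) < n%:R by near: n.
    have un : 0 < u n by near: n.
    have vn : 0 < v n by near: n.
    rewrite /ell /log_odds -/(r n) rE /logit.
    have -> : u n / (u n + v n) / (1 - u n / (u n + v n)) = u n / v n.
      by field; rewrite !gt_eqF ?addr_gt0// (addrC (u n)) addrK gt_eqF.
    have lnE (b x : R) : 0 < x -> ln (n%:R `^ b * x) = b * ln n%:R + ln x.
      move=> x0; rewrite lnM ?posrE//; last exact: powR_gt0.
      by rewrite ln_powR.
    rewrite (lnE _ _ un) (lnE _ _ vn) (@ln_div _ (u n) (v n)) ?posrE//.
    ring.
  rewrite LE; apply: cvgB; apply: continuous_cvg => //; exact: continuous_ln.
split.
  apply/eqaddoP => eps eps0; move/cvgrPdist_le : ell_cvg => /(_ _ eps0).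
  apply: filterS => n; rewrite normr1 mulr1 distrC; congr (`|_| <= _).
  rewrite /= !fctE /L opprD addrACA.
  by ring.
split; last 3 first.
- by case=> -[ba_gt _ _] [baE _ _]; move: ba_gt; rewrite baE ltxx.
- by case=> -[ba_gt _ _] [ba_lt _ _]; move: (lt_trans ba_gt ba_lt); rewrite ltxx.
- by case=> -[baE _ _] [ba_lt _ _]; move: ba_lt; rewrite baE ltxx.
have [ba_lt|ba_gt|baE] := ltgtP ba bb.
- have e0 : ba - bb < 0 by rewrite subr_lt0.
  right; right; split => //; first exact: cvg_log_oddsNy ell_cvg e0.
  exact: cvg_posterior0 ell_cvg r_sigma e0.
- have e0 : 0 < ba - bb by rewrite subr_gt0.
  left; split => //; first exact: cvg_log_oddsy ell_cvg e0.
  exact: asymp_posterior_compl ell_cvg r_sigma e0.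
- right; left; split => //; last exact: sigma_lt1.
  (* With equal exponents the Gamma factors cancel. *)
  have -> : cb / ca = cb * Gamma bb / (ca * Gamma ba).
    by rewrite baE; field; rewrite !gt_eqF// Gamma_gt0.
  by apply: cvg_posterior_sigma ell_cvg r_sigma _; rewrite baE subrr.
Unshelve. all: by end_near. Qed.
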